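(* Let $n>2$ be an integer, let $k$ be an odd integer with $1<k<2^{n}$, and let $r$ be the non-negative integer with $2^r<k<2^{r+1}$. Then $\{k2^{n+i}+1\mid i=0,1,\dots,n+r\}$ is the minimal system of generators of the numerical semigroup $P_k(n)=\langle\{k2^{n+i}+1\mid i\in\mathbb{N}\}\rangle$, and hence the embedding dimension of $P_k(n)$ is $\mathrm{e}(P_k(n))=n+r+1$.
   Context: $\mathbb{N}$ denotes the non-negative integers; $\langle A\rangle$ is the set of finite $\mathbb{N}$-linear combinations of elements of $A$. A system of generators $B$ of a numerical semigroup $S$ (i.e. $S=\langle B\rangle$) is minimal if no proper subset of $B$ generates $S$; every numerical semigroup has a unique finite minimal system of generators, and its cardinality is the embedding dimension $\mathrm{e}(S)$. *)

(* Defs.v *)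
From HB Require Import structures.
From mathcomp Require Import all_boot.
From mathcomp Require Import finmap.
From mathcomp Require Import boolp classical_sets functions cardinality.

Set Implicit Arguments.
Unset Strict Implicit.
Unset Printing Implicit Defensive.

Local Open Scope classical_set_scope.

Definition nat_span (A : set nat) : set nat :=
  [set x | exists (m : nat) (c a : 'I_m -> nat),
    (forall i, A (a i)) /\ x = \sum_(i < m) c i * a i].

Definition numerical_semigroup (S : set nat) : Prop :=
  [/\ S 0, (forall x y, S x -> S y -> S (x + y)) & finite_set (~` S)].

Definition minimal_generators (S B : set nat) : Prop :=
  nat_span B = S /\ (forall B' : set nat, B' `<` B -> nat_span B' <> S).

(* [get] selects the minimal system of generators, which exists, is unique and
   is finite when [S] is a numerical semigroup; the value is junk otherwise. *)
Definition embedding_dimension (S : set nat) : nat :=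
  #|` fset_set (get (minimal_generators S))|%fset.

Definition proth_semigroup (k n : nat) : set nat :=
  nat_span [set x | exists i : nat, x = k * 2 ^ (n + i) + 1].

(* Main.v *)
Require Import Defs.
From HB Require Import structures.
From mathcomp Require Import all_boot.
From mathcomp Require Import finmap.
From mathcomp Require Import boolp classical_sets functions cardinality.
From mathcomp Require Import zify.

(** Write [s_i = k 2^(n+i) + 1].  A sum of [N] generators [s_i] has the form
    [k 2^n A + N], where [A] is the sum of the powers [2^i], so that [N <= A].
    If it equals [s_m] with [N >= 2], then [A = 2^m - t] and [N = k 2^n t + 1]
    with [t >= 1], so [k 2^n < 2^m], which forces [m > n + r].  Hence
    [s_0, ..., s_(n+r)] are irreducible in the semigroup and lie in every
    system of generators.  Conversely, for [m > n + r], let [t] and [D] be the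
    quotient and remainder of [2^m - 1] by [k 2^n + 1]; it suffices to write [D]
    as a sum of at most [k 2^n t + 1] numbers [2^i - 1] with [i <= n + r], and a
    greedy choice uses at most [n + r + 1] of them. *)

Lemma nat_span_ind (A P : set nat) :
  P 0 -> (forall x y, P x -> P y -> P (x + y)) -> (forall x, A x -> P x) ->
  forall x, nat_span A x -> P x.
Proof.
move=> P0 PD AP x [m [c [a [Aa ->]]]].
apply: (big_ind P) => // i _; elim: (c i) => [|d IH]; first by rewrite mul0n.
by rewrite mulSn; apply: PD => //; apply: AP.
Qed.

Lemma nat_span0 (A : set nat) : nat_span A 0.
Proof.
by exists 0, (fun=> 0), (fun=> 0); split=> [[]//|]; rewrite big_ord0.
Qed.

Lemma nat_spanD (A : set nat) x y :
  nat_span A x -> nat_span A y -> nat_span A (x + y).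
Proof.
move=> [m [c [a [Aa ->]]]] [p [d [b [Ab ->]]]].
exists (m + p), (fun i => match fintype.split i with inl j => c j | inr j => d j end),
  (fun i => match fintype.split i with inl j => a j | inr j => b j end); split.
  by move=> i; case: (fintype.split i).
rewrite big_split_ord /=; congr (_ + _); apply: eq_bigr => i _.
  by rewrite (unsplitK (inl i)).
by rewrite (unsplitK (inr i)).
Qed.

Lemma nat_span_gen (A : set nat) x : A x -> nat_span A x.
Proof.
move=> Ax; exists 1, (fun=> 1), (fun=> x); split=> //.
by rewrite big_ord1 mul1n.
Qed.

Lemma nat_spanMl (A : set nat) c x : nat_span A x -> nat_span A (c * x).
Proof.
move=> Ax; elim: c => [|c IH]; first exact: nat_span0.
by rewrite mulSn; apply: nat_spanD.
Qed.

Lemma nat_span_min (A B : set nat) :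
  (A `<=` nat_span B -> nat_span A `<=` nat_span B)%classic.
Proof.
move=> AB; apply: nat_span_ind => //; first exact: nat_span0.
by move=> x y; apply: nat_spanD.
Qed.

Definition irreducible_in (S : set nat) (x : nat) : Prop :=
  x != 0 /\ forall u v, S u -> S v -> x = u + v -> u = 0 \/ v = 0.

(** Every element of the span is zero, a generator, or a sum of two nonzero elements of the span;
    irreducibility leaves only the second case. *)
Lemma irreducible_in_gen (B : set nat) x :
  nat_span B x -> irreducible_in (nat_span B) x -> B x.
Proof.
move=> Bx [x0 irr].
(* Membership is carried through the induction because a sum must be split into summands that lie in
   the span. *)
have [_ [xE|[//|[u [v [Bu Bv u0 v0 xE]]]]]] : nat_span B x /\ (x = 0 \/ B x \/
    exists u v, [/\ nat_span B u, nat_span B v, u != 0, v != 0 & x = u + v]).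
- move: x Bx {x0 irr}; apply: nat_span_ind => [|x y [Sx Px] [Sy Py]|x Bx].
  + by split; [exact: nat_span0|left].
  + split; first exact: nat_spanD.
    have [->|x0] := eqVneq x 0; first by rewrite add0n.
    have [->|y0] := eqVneq y 0; first by rewrite addn0.
    by right; right; exists x, y.
  + by split; [exact: nat_span_gen|right; left].
- by rewrite xE in x0.
- by case: (irr u v Bu Bv xE) => E; rewrite E in u0 v0.
Qed.

Lemma irreducible_gens_minimal (B : set nat) :
  (forall x, B x -> irreducible_in (nat_span B) x) ->
  minimal_generators (nat_span B) B.
Proof.
move=> irrB; split=> // B' [_ nBB'] E; apply: nBB' => x Bx.
by apply: irreducible_in_gen; rewrite E; [exact: nat_span_gen|exact: irrB].
Qed.

(** Irreducible elements lie in every generating set, so [B'] contains [B], and minimality of [B']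
    excludes strict inclusion. *)
Lemma irreducible_gens_unique (B B' : set nat) :
  (forall x, B x -> irreducible_in (nat_span B) x) ->
  minimal_generators (nat_span B) B' -> B' = B.
Proof.
move=> irrB [E minB'].
have BB' : (B `<=` B')%classic.
  move=> x Bx; apply: irreducible_in_gen; rewrite E; last exact: irrB.
  exact: nat_span_gen.
apply/seteqP; split=> //; apply: contrapT => nB'B.
by apply: (minB' B).
Qed.

Lemma embedding_dimension_irreducible (B : set nat) d :
  (B #= `I_d)%card -> (forall x, B x -> irreducible_in (nat_span B) x) ->
  embedding_dimension (nat_span B) = d.
Proof.
move=> Bd irrB; rewrite /embedding_dimension.
rewrite (irreducible_gens_unique _ _ irrB (getI (irreducible_gens_minimal _ irrB))).
exact: card_fset_set.
Qed.

(* [2 * a - 1] is [-1] modulo [a], hence [(a - x %% a) * (2 * a - 1)] is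
   congruent to [x]. *)
Lemma nat_span_cofinite (A : set nat) a :
  0 < a -> nat_span A a -> nat_span A (2 * a - 1) ->
  finite_set (~` nat_span A)%classic.
Proof.
move=> a0 Aa Ab.
apply: (@sub_finite_set _ _ (`I_(2 * a * a))%classic); last exact: finite_II.
move=> x nAx /=; rewrite ltnNge; apply/negP => xge; apply: nAx.
have lt_r := ltn_pmod x a0.
(* This bound keeps the truncated subtraction in the coefficient of [a] below exact. *)
have le_q : 2 * a <= x %/ a by rewrite leq_divRL.
have -> : x = (x %/ a + 1 - 2 * (a - x %% a)) * a + (a - x %% a) * (2 * a - 1).
  rewrite {1}(divn_eq x a).
  move: (x %/ a) (x %% a) lt_r le_q => q s lt_r le_q {x xge}.
  have [p aE] : exists p, a = s + p by exists (a - s); lia.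
  rewrite {}aE addKn in lt_r le_q *; have [u ->] : exists u, q = u + 2 * p by exists (q - 2 * p); lia.
  nia.
by apply: nat_spanD; apply: nat_spanMl.
Qed.

(** Greedy choice: removing the largest term [2 ^ J.+1 - 1] once leaves a number within the bound
    for [J], except when [D] is maximal, where two copies of that term suffice. *)
Lemma sum_pred_pow2 J D :
  D <= 2 * (2 ^ J - 1) ->
  exists s : seq nat, [/\ size s <= J.+1, all (fun i => i <= J) s &
                          \sum_(i <- s) (2 ^ i - 1) = D].
Proof.
elim: J D => [|J IH] D; first by rewrite leqn0 => /eqP ->; exists [::]; rewrite big_nil.
have J2 := expn_gt0 2 J; rewrite expnS => leD.
have widen s : all (fun i => i <= J) s -> all (fun i => i <= J.+1) s.
  by apply: sub_all => i /leqW.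
have [ltD|geD] := ltnP D (2 * 2 ^ J - 1).
  have [|s [szs /widen als sums]] := IH D; first by lia.
  by exists s; split=> //; apply: leqW.
have [->|neD] := eqVneq D (2 * (2 * 2 ^ J - 1)).
  exists [:: J.+1; J.+1]; split=> //=; first by rewrite leqnn.
  by rewrite !big_cons big_nil expnS; lia.
have [|s [szs /widen als sums]] := IH (D - (2 * 2 ^ J - 1)); first by lia.
exists (J.+1 :: s); split=> //=; first by rewrite leqnn.
by rewrite big_cons sums expnS; lia.
Qed.

Definition proth_gens (k n m : nat) : set nat :=
  [set x | exists i : nat, i <= m /\ x = k * 2 ^ (n + i) + 1]%classic.

Lemma nat_span_proth_gens_seq k n J (s : seq nat) :
  all (fun i => i <= J) s ->
  nat_span (proth_gens k n J)
    (k * 2 ^ n * (\sum_(i <- s) (2 ^ i - 1) + size s) + size s).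
Proof.
elim: s => [|i s IH] /=; first by rewrite big_nil muln0 => _; exact: nat_span0.
move=> /andP[iJ /IH IHs]; rewrite big_cons.
have -> : k * 2 ^ n * (2 ^ i - 1 + \sum_(j <- s) (2 ^ j - 1) + (size s).+1) +
    (size s).+1 = (k * 2 ^ (n + i) + 1) +
    (k * 2 ^ n * (\sum_(j <- s) (2 ^ j - 1) + size s) + size s).
  rewrite expnD; have : 0 < 2 ^ i by rewrite expn_gt0.
  by case: (2 ^ i) => // p _; rewrite subn1 /=; nia.
by apply: nat_spanD => //; apply: nat_span_gen; exists i.
Qed.

Lemma nat_span_proth_gens k n J D N :
  D <= 2 * (2 ^ J - 1) -> J < N ->
  nat_span (proth_gens k n J) (k * 2 ^ n * (D + N) + N).
Proof.
(* Padding with the index 0 raises the number of terms to [N] without changing the sum, as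
   [2 ^ 0 - 1 = 0]. *)
move=> /sum_pred_pow2 [s [szs als <-]] JN.
have sz : size (nseq (N - size s) 0 ++ s) = N.
  by rewrite size_cat size_nseq subnK //; lia.
have := nat_span_proth_gens_seq k n J (nseq (N - size s) 0 ++ s).
rewrite sz big_cat /= big_nseq iter_addn_0 mul0n add0n; apply.
by rewrite all_cat als all_nseq orbT.
Qed.

Lemma proth_generator_in_span k n r m :
  2 ^ r < k < 2 ^ r.+1 -> 0 < n ->
  nat_span (proth_gens k n (n + r)) (k * 2 ^ (n + m) + 1).
Proof.
move=> /andP[rk kr] n0.
have [mle|mgt] := leqP m (n + r); first by apply: nat_span_gen; exists m.
pose K := k * 2 ^ n; set t := (2 ^ m - 1) %/ (K + 1).
have n2 : 2 <= 2 ^ n by rewrite -[2 in X in X <= _]expn1 leq_exp2l.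
(* The remainder modulo [K + 1] is at most [K], so this bound brings it within reach of the greedy
   choice. *)
have Kub : K <= 2 * (2 ^ (n + r) - 1).
  by move: kr; rewrite /K expnS expnD; nia.
(* With [t >= 1], this makes the [K * t + 1] available terms more than [n + r]. *)
have Klb : n + r < K.
  apply: ltn_trans (ltn_expl _ (ltnSn 1)) _.
  by rewrite /K expnD mulnC ltn_pmul2r // expn_gt0.
have Km : K + 1 <= 2 ^ m - 1.
  have : 2 ^ (n + r).+1 <= 2 ^ m by rewrite leq_exp2l.
  by rewrite expnS; have := expn_gt0 2 (n + r); lia.
have t0 : 0 < t by rewrite divn_gt0 // addn1.
have -> : k * 2 ^ (n + m) + 1 =
    K * ((2 ^ m - 1) %% (K + 1) + (K * t + 1)) + (K * t + 1).
  have := divn_eq (2 ^ m - 1) (K + 1); rewrite -/t.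
  move: ((2 ^ m - 1) %% (K + 1)) => D E.
  have {E} -> : 2 ^ (n + m) = 2 ^ n * (t * (K + 1) + D + 1).
    by rewrite -E expnD subnK // expn_gt0.
  by rewrite mulnA -/K; nia.
apply: nat_span_proth_gens; last by nia.
have : (2 ^ m - 1) %% (K + 1) < K + 1 by rewrite ltn_mod addn1.
lia.
Qed.

Lemma proth_semigroupE k n r :
  2 ^ r < k < 2 ^ r.+1 -> 0 < n ->
  proth_semigroup k n = nat_span (proth_gens k n (n + r)).
Proof.
move=> kr n0; apply/seteqP; split; apply: nat_span_min.
  by move=> _ [i ->]; apply: proth_generator_in_span.
by move=> _ [i [_ ->]]; apply: nat_span_gen; exists i.
Qed.

(** [N] counts the generators used and [A] adds up their powers [2 ^ i], each at least 1. *)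
Lemma proth_semigroup_count k n x : proth_semigroup k n x ->
  exists A N, [/\ x = k * 2 ^ n * A + N, N <= A & N = 0 -> x = 0].
Proof.
move: x; apply: nat_span_ind => [|x y|x [i ->]].
- by exists 0, 0; rewrite muln0.
- move=> [A [N [xE NA N0]]] [A' [N' [yE NA' N0']]].
  exists (A + A'), (N + N'); split; [by rewrite xE yE; lia|by rewrite leq_add|].
  by move/eqP; rewrite addn_eq0 => /andP[/eqP/N0 -> /eqP/N0' ->].
- by exists (2 ^ i), 1; rewrite expn_gt0 expnD mulnA.
Qed.

Lemma proth_generator_irreducible k n i :
  2 ^ i <= k * 2 ^ n -> irreducible_in (proth_semigroup k n) (k * 2 ^ (n + i) + 1).
Proof.
move=> leK; split=> [|u v]; first by rewrite addn1.
move=> /proth_semigroup_count [A [N [uE NA N0]]].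
move=> /proth_semigroup_count [A' [N' [vE NA' N0']]] E.
have [/N0|Ngt] := posnP N; first by left.
have [/N0'|Ngt'] := posnP N'; first by right.
exfalso; move: E leK; rewrite uE vE expnD mulnA.
move: (k * 2 ^ n) (2 ^ i) => K p E leK.
(* If [A + A' >= p], then [N + N' <= 1], although both are positive. Otherwise
   [N + N' >= K + 1 > p > A + A'], against [N <= A] and [N' <= A']. *)
have [ltA|geA] := ltnP (A + A') p; last by nia.
nia.
Qed.

Theorem theorem4 (n k r : nat) (hn : 2 < n) (hk_odd : odd k)
    (hk : 1 < k < 2 ^ n) (hr : 2 ^ r < k < 2 ^ r.+1) :
  [/\ numerical_semigroup (proth_semigroup k n),
      minimal_generators (proth_semigroup k n)
        [set x | exists i : nat, i <= n + r /\ x = k * 2 ^ (n + i) + 1]%classic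
    & embedding_dimension (proth_semigroup k n) = n + r + 1].
Proof.
have SE : proth_semigroup k n = nat_span (proth_gens k n (n + r)).
  by apply: proth_semigroupE => //; lia.
have [rk _] := andP hr.
have irr x : proth_gens k n (n + r) x ->
    irreducible_in (nat_span (proth_gens k n (n + r))) x.
  move=> [i [ile ->]]; rewrite -SE; apply: proth_generator_irreducible.
  apply: (@leq_trans (2 ^ (n + r))); first by rewrite leq_exp2l.
  by rewrite expnD mulnC leq_mul2r (ltnW rk) orbT.
split.
- split; first exact: nat_span0.
    by move=> x y; apply: nat_spanD.
  (* For [a = s_0], the number [2 * a - 1] is exactly the next generator [s_1]. *)
  apply: (nat_span_cofinite _ (k * 2 ^ n + 1)); first by rewrite addn1.
    by apply: nat_span_gen; exists 0; rewrite addn0.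
  by apply: nat_span_gen; exists 1; rewrite expnD expn1; lia.
- by rewrite SE; apply: irreducible_gens_minimal.
- rewrite SE; apply: embedding_dimension_irreducible => //.
  have -> : proth_gens k n (n + r) =
      ((fun i => k * 2 ^ (n + i) + 1) @` `I_(n + r + 1))%classic.
    apply/seteqP; split=> [_ [i [ile ->]]|_ [i /= ilt <-]].
      by exists i => //=; lia.
    by exists i; split=> //; lia.
  apply: inj_card_eq => i j _ _ /addIn /eqP.
  have k0 : 0 < k by lia.
  by rewrite eqn_pmul2l // eqn_exp2l // eqn_add2l => /eqP.
Qed.
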